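(* Let $P$ be a Markov transition kernel on $\mathbf{X}$ having a unique invariant probability measure $\Pi$. Let $V : \mathbf{X} \to [0,\infty)$ be Borel measurable and suppose there is a constant $K\in(0,\infty)$ with $PV(x)\le K$ for all $x\in\mathbf{X}$. Suppose there are $r>1$, a constant $\alpha_r\in(0,1]$ and a probability measure $\nu$ on $\mathbf{X}$ such that $P(x,B)\ge\alpha_r\nu(B)$ for every Borel $B\subseteq\mathbf{X}$ and every $x$ with $V(x)\le rK$. Let $\gamma_r=1-1/r$. Suppose further that there exists a metric $d$ on $\mathbf{X}$ such that $(\mathbf{X},d)$ is a complete separable metric space and that, for some $x_0\in\mathbf{X}$ and some concave nondecreasing function $c:[0,\infty)\to[0,\infty)$, $$d(x,x_0)\le c(V(x))\qquad\text{for all }x\in\mathbf{X}.$$ Then for all $x\in\mathbf{X}$ and all integers $t\ge0$, $$W_d\big(P^{t+1}(x,\cdot),\Pi\big)\le 2\,c(K)\,\rho_t(\gamma_r,\alpha_r).$$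
   Context: $\mathbf{X}$ carries the Borel $\sigma$-algebra of $(\mathbf{X},d)$. For a Borel function $f$, $Pf(x) = \int_{\mathbf{X}} f(y)\,P(x,dy)$; $P^t$ denotes the $t$-step kernel. A probability measure $\Pi$ is invariant if $\int P(y,\cdot)\,\Pi(dy)=\Pi(\cdot)$. The Wasserstein distance is $W_d(\mu,\Pi)=\inf_{\Gamma}\int_{\mathbf{X}\times\mathbf{X}} d(x,y)\,\Gamma(dx,dy)$, the infimum over all Borel probability measures $\Gamma$ on $\mathbf{X}\times\mathbf{X}$ with marginals $\mu$ and $\Pi$. For $\gamma\in(0,1)$ and $\alpha\in(0,1]$ (with $\wedge,\vee$ the minimum and maximum), $$\lambda_{\pm}(\gamma,\alpha) = \frac{1-\gamma\wedge\alpha \pm \sqrt{(1-\gamma\wedge\alpha)^2 + 4(\gamma\wedge\alpha)(1-\alpha\vee\gamma)}}{2},$$ and for integers $t\ge0$ (with $0^0=1$) $$\rho_t(\gamma,\alpha) = \frac{(1-\lambda_-(\gamma,\alpha))\,\lambda_+(\gamma,\alpha)^t - (1-\lambda_+(\gamma,\alpha))\,\lambda_-(\gamma,\alpha)^t}{\lambda_+(\gamma,\alpha)-\lambda_-(\gamma,\alpha)}.$$ *)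

(* Defs.v *)
From HB Require Import structures.
From mathcomp Require Import all_boot all_order all_algebra.
From mathcomp Require Import all_classical all_reals all_analysis.

Set Implicit Arguments.
Unset Strict Implicit.
Unset Printing Implicit Defensive.
Import Order.TTheory GRing.Theory Num.Theory.
Import numFieldNormedType.Exports.

Local Open Scope classical_set_scope.
Local Open Scope convex_scope.
Local Open Scope ring_scope.

(* [completeType] comes with a distinguished point: this only asks that the
   space be nonempty, as it is as soon as it carries a probability measure. *)
#[short(type="completeMetricType")]
HB.structure Definition CompleteMetric (R : numDomainType) :=
  { T of Complete T & Metric R T }.

Definition separable (T : topologicalType) :=
  exists2 S : set T, countable S & dense S.

Notation borel T := (g_sigma_algebraType (@open T)).

(* Same shape as [convex_function], with the inequality reversed. *)
Definition concave_function (R : numFieldType) (E : lmodType R)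
    (E' := convex_lmodType E) (D : set E') (f : E' -> R^o) :=
  forall t : {i01 R},
    {in D &, forall x y : E',
      (f x <| t |> f y <= f (x <| t |> y))%R}.

Section markov_kernel.
Context d (X : measurableType d) (R : realType).
Local Open Scope ereal_scope.

Section composition.
Variables k1 k2 : R.-pker X ~> X.

Definition kcompose : X -> {measure set X -> \bar R} := mkcomp_noparam k1 k2.

HB.instance Definition _ := SubProbabilityKernel.on kcompose.

Let prob_kcompose x : kcompose x [set: X] = 1.
Proof.
rewrite /kcompose /mkcomp_noparam/= /kcomp_noparam.
under eq_integral do rewrite prob_kernel.
by rewrite integral_cst// mul1e prob_kernel.
Qed.

HB.instance Definition _ :=
  isProbabilityKernel.Build _ _ X X R kcompose prob_kcompose.

End composition.

(* [kiter P t] is P^t, with P^0(x, -) the Dirac mass at x and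
   P^(t+1)(x, A) = \int P^t(y, A) P(x, dy). *)
Fixpoint kiter (P : R.-pker X ~> X) (t : nat) : R.-pker X ~> X :=
  if t is s.+1 then kcompose P (kiter P s) else kdirac (@measurable_id _ X setT).

Definition invariant (P : R.-pker X ~> X) (Pi : probability X R) :=
  forall A, measurable A -> \int[Pi]_y P y A = Pi A.

(* Measures are compared on measurable sets only, as the value of a
   [{measure set X -> \bar R}] on other sets is unspecified. *)
Definition unique_invariant (P : R.-pker X ~> X) (Pi : probability X R) :=
  invariant P Pi /\
  forall Pi' : probability X R, invariant P Pi' ->
    forall A, measurable A -> Pi' A = Pi A.

End markov_kernel.

Section wasserstein.
Context (R : realType) (X : completeMetricType R).
Local Open Scope ereal_scope.
Implicit Types mu nu : {measure set (borel X) -> \bar R}.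

(* The sigma-algebra on X * X is the Borel sigma-algebra of the product
   topology. *)
Definition coupling mu nu : set (probability (borel (X * X)%type) R) :=
  [set G | forall A : set (borel X), measurable A ->
     pushforward G (fst : borel (X * X)%type -> borel X) A = mu A /\
     pushforward G (snd : borel (X * X)%type -> borel X) A = nu A].

(* Valued in \bar R: it is +oo when mu and nu have no coupling of finite
   cost. *)
Definition wasserstein mu nu : \bar R :=
  ereal_inf [set \int[G]_z (mdist (z.1 : X) (z.2 : X))%:E
            | G in coupling mu nu].

End wasserstein.

Section rate.
Context (R : realType).
Implicit Types gamma alpha : R.

Let discr gamma alpha : R :=
  (1 - Num.min gamma alpha) ^+ 2
  + 4 * Num.min gamma alpha * (1 - Num.max alpha gamma).

Definition lambda_plus gamma alpha : R :=
  (1 - Num.min gamma alpha + Num.sqrt (discr gamma alpha)) / 2.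

Definition lambda_minus gamma alpha : R :=
  (1 - Num.min gamma alpha - Num.sqrt (discr gamma alpha)) / 2.

Definition rho gamma alpha (t : nat) : R :=
  ((1 - lambda_minus gamma alpha) * lambda_plus gamma alpha ^+ t
   - (1 - lambda_plus gamma alpha) * lambda_minus gamma alpha ^+ t)
  / (lambda_plus gamma alpha - lambda_minus gamma alpha).

End rate.

(* Main.v *)
Require Import Defs.
From HB Require Import structures.
From mathcomp Require Import all_boot all_order all_algebra.
From mathcomp Require Import all_classical all_reals all_analysis.
From mathcomp Require Import measurable_realfun ring lra.

Set Implicit Arguments.
Unset Strict Implicit.
Unset Printing Implicit Defensive.
Import Order.TTheory GRing.Theory Num.Theory.
Import numFieldNormedType.Exports.

Local Open Scope classical_set_scope.
Local Open Scope ring_scope.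

(** Write gamma for 1 - 1/r and C for the sublevel set of V at height r K.  By
    Markov's inequality the drift condition makes every one-step law P(x, -)
    charge C with mass at least gamma, and from C the chain can be regenerated
    with probability alpha, its next state being then drawn from nu.  Follow a
    single chain and mark its state when it is known to lie in C.  An unmarked
    state becomes marked with probability gamma.  A marked state regenerates
    with probability alpha; in the worst case nu lives on C and uses up the mass
    alpha of the mass gamma that P(x, -) gives to C, so that only
    (gamma - alpha)^+ is left to mark the next state.  The probability of not
    having regenerated by time t, from an unmarked state, satisfies a two-term
    linear recursion whose characteristic roots are lambda_plus and
    lambda_minus, and it equals rho_t (rho_survival).

    These transition probabilities do not depend on the point, hence neither
    does the law of the part that has regenerated: there is one measure m, of
    mass 1 - rho_t, below all the laws P^t(x, -) (kiter_minorization), and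
    therefore also below Pi, which is a mixture of them.  Write
    P^t(x, -) = m + D1 and Pi = m + D2, where D1 and D2 have mass rho_t, and
    apply P once more: P^(t+1)(x, -) = mP + D1 P and Pi = mP + D2 P.  Coupling
    the common part mP with itself along the diagonal and the two residuals
    independently costs at most the integral of d(-, x0) against D1 P plus the
    same against D2 P (wasserstein_le_residual).

    The extra step is what makes these integrals small.  As PV <= K everywhere,
    the integral of V against D P is at most K rho_t for any D of mass rho_t.
    A supporting line of c at K (concave_supporting_line) bounds d(-, x0) by an
    affine function of V with the value c(K) at V = K, so each of the two
    integrals is at most c(K) rho_t (integral_bind_drift_le); this is Jensen's
    inequality for c. *)

(** * Finite measures *)

Section measures_and_kernels.
Local Open Scope ereal_scope.
Context (R : realType).

(** The measure m k.  Regarding m as a kernel out of a one-point space makes it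
    a composition of kernels, for which integration is iterated
    integration. *)
Lemma kernel_bind d d' (X : measurableType d) (Y : measurableType d')
    (m : {measure set X -> \bar R}) (k : R.-pker X ~> Y) :
    m setT < +oo ->
  exists m' : {measure set Y -> \bar R},
    (forall A, m' A = \int[m]_x k x A) /\
    (forall f : Y -> \bar R,
       (forall y, 0 <= f y) -> measurable_fun [set: Y] f ->
       \int[m']_y f y = \int[m]_x \int[k x]_y f y).
Proof.
move=> mfin.
pose l : unit -> {measure set X -> \bar R} := fun=> m.
have mk U : measurable U -> measurable_fun [set: unit] (l ^~ U).
  by move=> _; exact: measurable_cst.
have ub : measure_fam_uub l.
  exists (fine (m setT) + 1)%R => x.
  by rewrite /l EFinD fineK ?lteDl ?ge0_fin_numE// lte01.
pose l1 : R.-ker unit ~> X := HB.pack l (isKernel.Build _ _ _ _ R l mk).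
pose l2 : R.-fker unit ~> X :=
  HB.pack l l1 (Kernel_isFinite.Build _ _ _ _ R l1 ub).
exists (mkcomp l2 (@kernel.kernel_snd _ _ _ unit X Y R k) tt).
split=> [A|f f0 mf]; first by [].
by rewrite [LHS](@integral_kcomp _ _ _ _ _ _ _ l2 (kernel.kernel_snd k) tt f).
Qed.

(** Product measures and couplings are formed from bundled finite measures and
    probabilities; this and the next lemma provide the bundles for measures
    whose total mass is only known from an equation. *)
Lemma finite_measure_of d (X : measurableType d)
    (m : {measure set X -> \bar R}) :
    m setT < +oo ->
  exists m' : {finite_measure set X -> \bar R}, forall A, m' A = m A.
Proof.
move=> mT; have : fin_num_fun m by apply: lty_fin_num_fun.
case: m mT => m cm _ /= fm.
pose M : {measure set X -> \bar R} := HB.pack m cm.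
pose m' : {finite_measure set X -> \bar R} :=
  HB.pack m M (Measure_isFinite.Build _ _ R M fm).
by exists m'.
Qed.

Lemma probability_of d (X : measurableType d) (m : {measure set X -> \bar R}) :
  m setT = 1 -> exists m' : probability X R, forall A, m' A = m A.
Proof.
case: m => m cm /= mT.
pose M : {measure set X -> \bar R} := HB.pack m cm.
pose m' : probability X R :=
  HB.pack m M (Measure_isProbability.Build _ _ R M mT).
by exists m'.
Qed.

(** The set function m2 - m1 is a measure.  It is extended by 0 to sets that are
    not measurable, where m2 - m1 could be negative. *)
Lemma measure_residual d (X : measurableType d)
    (m1 m2 : {measure set X -> \bar R}) :
    m2 setT < +oo -> (forall A, measurable A -> m1 A <= m2 A) ->
  exists m : {measure set X -> \bar R},
    forall A, measurable A -> m2 A = m1 A + m A.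
Proof.
move=> m2fin m12.
have fin2 A : measurable A -> m2 A \is a fin_num.
  move=> mA; rewrite ge0_fin_numE//; apply: le_lt_trans m2fin.
  by apply: le_measure; rewrite ?inE.
have fin1 A : measurable A -> m1 A \is a fin_num.
  move=> mA; rewrite ge0_fin_numE//; apply: le_lt_trans (m12 _ mA) _.
  by rewrite -ge0_fin_numE// fin2.
pose m A : \bar R := if `[< measurable A >] then m2 A - m1 A else 0.
have mE A : measurable A -> m A = m2 A - m1 A by rewrite /m => /asboolT ->.
have m0 : m set0 = 0 by rewrite mE// !measure0 sube0.
have m_ge0 A : 0 <= m A.
  by rewrite /m; case: asboolP => // mA; rewrite sube_ge0 ?m12// fin1 ?orbT.
have m_add : semi_sigma_additive m.
  move=> F mF tF mUF; rewrite mE//.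
  rewrite (_ : (fun n => _) = fun n => (\sum_(0 <= i < n) m2 (F i)) -
                                       (\sum_(0 <= i < n) m1 (F i))).
    apply: cvgeB; first by rewrite fin_num_adde_defl// fin_numN fin1.
    - exact: (@measure_semi_sigma_additive _ _ _ m2).
    - exact: (@measure_semi_sigma_additive _ _ _ m1).
  apply/funext => n; under eq_bigr do rewrite mE//.
  elim: n => [|n IH]; first by rewrite !big_nil sube0.
  rewrite !big_nat_recr//= IH; apply/esym.
  rewrite fin_num_oppeD; last by rewrite fin1.
  by rewrite addeACA.
pose mm := isMeasure.Build _ X R m m0 m_ge0 m_add.
pose mM : {measure set X -> \bar R} := HB.pack m mm.
exists mM => A mA; rewrite /mM/=.
by rewrite mE// addeC subeK// fin1.
Qed.

(** Only a lower bound a on the mass of C is available, yet the conclusion is an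
    exact mixture with weights a and q - a, whichever of u and v is larger.
    When v <= u the bound u alone is better than the mixture; when u < v the
    indicator of C has the nonnegative weight v - u, and replacing the mass of C
    by a only lowers the value. *)
Lemma integral_ge_two_levels d (X : measurableType d)
    (m : {measure set X -> \bar R}) (C : set X) (g : X -> \bar R)
    (q a u v : R) :
    measurable C -> measurable_fun [set: X] g -> m setT = q%:E ->
    (0 <= a)%R -> a%:E <= m C -> (0 <= u)%R -> (0 <= v)%R ->
    (forall x, u%:E <= g x) -> (forall x, C x -> v%:E <= g x) ->
  ((q - a) * u + a * v)%:E <= \int[m]_x g x.
Proof.
move=> mC mg mT a0 aC u0 v0 gu gv.
have g0 x : 0 <= g x by apply: le_trans (gu x); rewrite lee_fin.
have [vu|uv] := leP v u.
  apply: (@le_trans _ _ (\int[m]_x u%:E)).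
    rewrite integral_cst// mT -EFinM lee_fin.
    rewrite -subr_ge0 (_ : _ - _ = a * (u - v))%R; last by ring.
    by rewrite mulr_ge0 ?subr_ge0.
  by apply: ge0_le_integral => //; move=> x _; rewrite lee_fin.
have uv0 : (0 <= v - u)%R by rewrite subr_ge0 ltW.
apply: (@le_trans _ _ (\int[m]_x (u%:E + (v - u)%:E * (\1_C x)%:E))).
  rewrite ge0_integralD//; last 2 first.
  - by move=> x _; rewrite mule_ge0// lee_fin.
  - by apply: measurable_funeM; exact/measurable_EFinP.
  rewrite integral_cst// mT ge0_integralZl//; last first.
    by apply/measurable_EFinP.
  rewrite integral_indic// setIT.
  apply: (@le_trans _ _ ((u * q)%:E + (v - u)%:E * a%:E)).
    by rewrite -EFinM -EFinD lee_fin le_eqVlt; apply/orP; left; apply/eqP; ring.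
  by rewrite EFinM leeD2l// lee_pmul2l// lte_fin subr_gt0.
apply: ge0_le_integral => //.
- by move=> x _; rewrite adde_ge0 ?mule_ge0 ?lee_fin.
- apply: emeasurable_funD => //; apply: measurable_funeM.
  exact/measurable_EFinP.
- move=> x _; rewrite indicE; have [xC|xC] := boolP (x \in C).
    by rewrite mule1 -EFinD addrC subrK gv// -inE.
  by rewrite mule0 adde0.
Qed.

End measures_and_kernels.

(** * Iterates of a Markov kernel *)

Section iterates.
Local Open Scope ereal_scope.
Context d (X : measurableType d) (R : realType).
Implicit Types (P : R.-pker X ~> X) (Pi : probability X R).

Lemma integral_kiterS P t x (f : X -> \bar R) :
    (forall y, 0 <= f y) -> measurable_fun [set: X] f ->
  \int[kiter P t.+1 x]_y f y = \int[P x]_y \int[kiter P t y]_z f z.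
Proof.
move=> f0 mf.
have Pfin : P x setT < +oo by rewrite prob_kernel ltry.
have [m [mE <-//]] := kernel_bind (kiter P t) Pfin.
by apply: eq_measure_integral => A mA _; rewrite mE.
Qed.

(** The iterates are defined by putting the new step first; this moves it to
    the end, where the drift condition can be used. *)
Lemma kiterSr P t x A : measurable A ->
  kiter P t.+1 x A = \int[kiter P t x]_y P y A.
Proof.
move=> mA; elim: t x => [|t IH] x.
  have -> : kiter P 1 x A = \int[P x]_y kiter P 0 y A by [].
  rewrite (eq_integral (fun y => (\1_A y)%:E)); last first.
    by move=> y _; rewrite /= /kdirac diracE indicE.
  rewrite integral_indic// setIT integral_dirac//.
    by rewrite diracT mul1e.
  exact: measurable_kernel.
rewrite integral_kiterS//; last exact: measurable_kernel.
by apply: eq_integral => y _; rewrite -IH.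
Qed.

Lemma invariant_kiter P Pi t A : Defs.invariant P Pi -> measurable A ->
  \int[Pi]_x kiter P t x A = Pi A.
Proof.
move=> PiP mA; elim: t => [|t IH].
  rewrite (eq_integral (fun y => (\1_A y)%:E)); last first.
    by move=> y _; rewrite /= /kdirac diracE indicE.
  by rewrite integral_indic// setIT.
have Pifin : Pi setT < +oo by rewrite probability_setT ltry.
have [m [mE mint]] := kernel_bind P Pifin.
rewrite -[RHS]IH -[RHS](@eq_measure_integral _ _ _ _ Pi m); last first.
  by move=> B mB _; rewrite mE PiP.
by rewrite mint//; exact: measurable_kernel.
Qed.

End iterates.

(** * The rate as a survival probability *)

Section rate_recursion.
Variable R : realType.
Implicit Types gamma alpha : R.

(** Probabilities of no regeneration within t steps, from an unmarked state
    (first component) and from a marked one (second component), for the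
    two-state chain described at the top.  The term
    Num.max alpha gamma - alpha is the positive part of gamma - alpha. *)
Fixpoint survival gamma alpha (t : nat) : R * R :=
  if t is s.+1 then
    let: (u, v) := survival gamma alpha s in
    ((1 - gamma) * u + gamma * v,
     (1 - Num.max alpha gamma) * u + (Num.max alpha gamma - alpha) * v)
  else (1, 1).

(** The two-state matrix has trace 1 - m and determinant - m (1 - M), where m
    and M are the minimum and maximum of gamma and alpha, both when gamma <= alpha
    and when alpha < gamma.  So the survival probability and rho satisfy the
    same two-term recursion, and both are 1 at times 0 and 1. *)
Lemma rho_survival gamma alpha t :
  0 < gamma -> gamma < 1 -> 0 < alpha -> alpha <= 1 ->
  rho gamma alpha t = (survival gamma alpha t).1.
Proof.
move=> g0 g1 a0 a1.
pose m := Num.min gamma alpha; pose M := Num.max alpha gamma.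
pose D := (1 - m) ^+ 2 + 4 * m * (1 - M).
have m1 : m < 1 by rewrite /m gt_min g1.
have m0 : 0 < m by rewrite /m lt_min g0 a0.
have M1 : M <= 1 by rewrite /M ge_max a1 ltW.
(* gamma < 1 keeps the two roots apart, also when alpha = 1. *)
have D0 : 0 < D.
  rewrite /D ltr_pwDl ?exprn_gt0 ?subr_gt0//.
  by rewrite mulr_ge0 ?subr_ge0// mulr_ge0// ltW.
pose p := lambda_plus gamma alpha; pose q := lambda_minus gamma alpha.
have pqD : p - q = Num.sqrt D.
  by rewrite /p /q /lambda_plus /lambda_minus -/m -/M -/D; field.
have pq0 : p - q != 0 by rewrite pqD gt_eqF// sqrtr_gt0.
have sD : Num.sqrt D ^+ 2 = D by rewrite sqr_sqrtr// ltW.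
have pE : p ^+ 2 = (1 - m) * p + m * (1 - M).
  rewrite /p /lambda_plus -/m -/M -/D.
  apply/eqP; rewrite -subr_eq0; apply/eqP.
  transitivity ((Num.sqrt D ^+ 2 - D) / 4); last by rewrite sD subrr mul0r.
  by rewrite /D; field.
have qE : q ^+ 2 = (1 - m) * q + m * (1 - M).
  rewrite /q /lambda_minus -/m -/M -/D.
  apply/eqP; rewrite -subr_eq0; apply/eqP.
  transitivity ((Num.sqrt D ^+ 2 - D) / 4); last by rewrite sD subrr mul0r.
  by rewrite /D; field.
have rhoE s :
    rho gamma alpha s = ((1 - q) * p ^+ s - (1 - p) * q ^+ s) / (p - q).
  by [].
have rhoSS s : rho gamma alpha s.+2 =
    (1 - m) * rho gamma alpha s.+1 + m * (1 - M) * rho gamma alpha s.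
  rewrite !rhoE.
  have -> : p ^+ s.+2 = p ^+ s * ((1 - m) * p + m * (1 - M)).
    by rewrite -pE -exprD addn2.
  have -> : q ^+ s.+2 = q ^+ s * ((1 - m) * q + m * (1 - M)).
    by rewrite -qE -exprD addn2.
  by rewrite !exprSr; field.
have survSS s : (survival gamma alpha s.+2).1 =
    (1 - m) * (survival gamma alpha s.+1).1
    + m * (1 - M) * (survival gamma alpha s).1.
  rewrite /=; case: (survival gamma alpha s) => u v /=.
  rewrite /m /M; have [ga|ag] := leP gamma alpha; by ring.
suff : rho gamma alpha t = (survival gamma alpha t).1 /\
       rho gamma alpha t.+1 = (survival gamma alpha t.+1).1 by case.
elim: t => [|t [IH1 IH2]]; last by rewrite rhoSS survSS IH1 IH2.
rewrite !rhoE /= !expr0 !expr1 !mulr1; split.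
  by rewrite -[RHS](divff pq0); congr (_ / _); ring.
by rewrite subrK -[RHS](divff pq0); congr (_ / _); ring.
Qed.

End rate_recursion.

(** * A uniform minorization of the iterates *)

Section minorization.
Local Open Scope ereal_scope.
Context d (X : measurableType d) (R : realType).

(** Condition on the first step.  From an arbitrary point, P(x, -) has mass at
    least gamma on C, where the bound R1 is available, and R0 is available
    elsewhere.  From a point of C, split P(x, -) = alpha nu + Q: the first part
    contributes alpha nu P^t, and Q has mass 1 - alpha, of which at least
    (gamma - alpha)^+ is on C since nu has mass at most 1 there.  The weights
    are those of the two-state chain, so the masses follow it too. *)
Lemma kiter_minorization (P : R.-pker X ~> X) (C : set X) (nu : probability X R)
    (gamma alpha : R) (t : nat) :
    measurable C -> (0 <= gamma <= 1)%R -> (0 <= alpha <= 1)%R ->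
    (forall x, gamma%:E <= P x C) ->
    (forall x, C x -> forall B, measurable B -> alpha%:E * nu B <= P x B) ->
  exists R0 R1 : {measure set X -> \bar R},
    [/\ R0 setT = (1 - (survival gamma alpha t).1)%:E,
        R1 setT = (1 - (survival gamma alpha t).2)%:E,
        forall x A, measurable A -> R0 A <= kiter P t x A &
        forall x A, C x -> measurable A -> R1 A <= kiter P t x A].
Proof.
move=> mC /andP[g0 g1] /andP[a0 a1] PC PCnu.
pose M := Num.max alpha gamma.
have M1 : (0 <= 1 - M)%R by rewrite subr_ge0 ge_max a1.
have Ma : (0 <= M - alpha)%R by rewrite subr_ge0 le_max lexx.
have g1' : (0 <= 1 - gamma)%R by rewrite subr_ge0.
elim: t => [|t [R0 [R1 []]]] /=.
  exists mzero, mzero; split => //=; rewrite ?/mzero ?subrr//.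
case E : (survival gamma alpha t) => [u v] /= R0T R1T R0P R1P.
have nufin : nu setT < +oo by rewrite probability_setT ltry.
have [nut [nutE _]] := kernel_bind (kiter P t) nufin.
pose R0' : {measure set X -> \bar R} :=
  measure_add (mscale (NngNum g1') R0) (mscale (NngNum g0) R1).
pose R1' : {measure set X -> \bar R} :=
  measure_add (mscale (NngNum a0) nut)
    (measure_add (mscale (NngNum M1) R0) (mscale (NngNum Ma) R1)).
have R0'E A : R0' A = (1 - gamma)%:E * R0 A + gamma%:E * R1 A.
  exact: measure_addE.
have R1'E A : R1' A =
    alpha%:E * nut A + ((1 - M)%:E * R0 A + (M - alpha)%:E * R1 A).
  by rewrite [LHS]measure_addE; congr (_ + _); exact: measure_addE.
have fin (m : {measure set X -> \bar R}) (r : R) A :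
    m setT = r%:E -> measurable A -> m A \is a fin_num.
  move=> mT mA; rewrite ge0_fin_numE//; apply: (@le_lt_trans _ _ (m setT)).
    by apply: le_measure; rewrite ?inE.
  by rewrite mT ltry.
(* A first step of law m, with a known amount a of mass on C. *)
have mixed (m : {measure set X -> \bar R}) (q a : R) A :
    m setT = q%:E -> (0 <= a)%R -> a%:E <= m C -> measurable A ->
    (q - a)%:E * R0 A + a%:E * R1 A <= \int[m]_y kiter P t y A.
  move=> mT a_ge0 aC mA.
  rewrite -(fineK (fin _ _ _ R0T mA)) -(fineK (fin _ _ _ R1T mA)) -!EFinM -EFinD.
  apply: (@integral_ge_two_levels _ _ _ _ C) => //.
  - exact: measurable_kernel.
  - by move=> x; rewrite fineK ?(fin _ _ _ R0T mA)// R0P.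
  - by move=> x Cx; rewrite fineK ?(fin _ _ _ R1T mA)// R1P.
exists R0', R1'; split.
- by rewrite R0'E R0T R1T -!EFinM -EFinD; congr (_%:E); ring.
- have nutT : nut setT = 1.
    rewrite nutE (eq_integral (fun=> 1)); last by move=> y _; rewrite prob_kernel.
    by rewrite integral_cst// mul1e; exact: probability_setT.
  by rewrite -/M R1'E R0T R1T nutT mule1 -!EFinM -!EFinD; congr (_%:E); ring.
- move=> x A mA; rewrite R0'E; apply: mixed => //; exact: prob_kernel.
move=> x A Cx mA; rewrite R1'E.
have Pfin : P x setT < +oo by rewrite prob_kernel ltry.
pose anu : {measure set X -> \bar R} := mscale (NngNum a0) nu.
(* Q is the law of the first step without its regenerated part. *)
have [Q PQ] : exists m : {measure set X -> \bar R},
    forall A, measurable A -> P x A = anu A + m A.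
  by apply: measure_residual => // B mB; rewrite /anu /mscale/= PCnu.
have QT : Q setT = (1 - alpha)%:E.
  have anuT : anu setT = alpha%:E.
    by rewrite -[RHS]mule1 -(probability_setT nu).
  have := PQ _ measurableT; rewrite prob_kernel anuT EFinB => ->.
  by rewrite addeAC subee// add0e.
have QC : (M - alpha)%:E <= Q C.
  have [ag|ga] := leP alpha gamma; last first.
    by rewrite /M (max_idPl _) ?subrr// ltW.
  rewrite /M (max_idPr _)// EFinB leeBlDr//.
  apply: (le_trans (PC x)); rewrite PQ// addeC leeD2l//.
  rewrite /anu /mscale/= -[leRHS]mule1 lee_wpmul2l ?lee_fin//.
  exact: probability_le1.
have -> : kiter P t.+1 x A = \int[P x]_y kiter P t y A by [].
rewrite (@eq_measure_integral _ _ _ _ (measure_add anu Q)); last first.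
  by move=> B mB _; rewrite PQ//; exact/esym/measure_addE.
rewrite ge0_integral_measure_add//; last exact: measurable_kernel.
rewrite ge0_integral_mscale//; last exact: measurable_kernel.
rewrite /= -nutE leeD2l//.
have -> : (1 - M = (1 - alpha) - (M - alpha))%R by ring.
exact: mixed.
Qed.

End minorization.

(** * Supporting lines of concave functions *)

Section supporting_line.
Variable R : realType.

Lemma concave_function_ge (c : R -> R) :
    @concave_function R R^o [set` `[0 : R, +oo[] c ->
  forall t x y : R, 0 <= t -> t <= 1 -> 0 <= x -> 0 <= y ->
    t * c x + (1 - t) * c y <= c (t * x + (1 - t) * y).
Proof.
move=> cc t x y t0 t1 x0 y0.
have t01 : t \in `[0, 1]%R by rewrite in_itv/= t0.
have itv (z : R) : 0 <= z -> z \in [set` `[0 : R, +oo[].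
  by move=> z0; rewrite inE/= in_itv/= z0.
have := cc (@Itv01 R t t0 t1) x y (itv _ x0) (itv _ y0).
by [].
Qed.

(** The slope is the supremum of the slopes of the chords to the right of k,
    which by concavity lies below the slope of every chord to the left of k.
    Monotonicity makes it nonnegative, and comparison with the chord from 0 to
    k, together with c 0 >= 0, gives s * k <= c k: the line is nonnegative at
    0. *)
Lemma concave_supporting_line (c : R -> R) (k : R) :
    0 < k -> (forall u : R, 0 <= u -> 0 <= c u) ->
    {in `[0, +oo[ &, nondecreasing_fun c} ->
    @concave_function R R^o [set` `[0 : R, +oo[] c ->
  exists s, [/\ 0 <= s, s * k <= c k &
    forall u, 0 <= u -> c u <= c k + s * (u - k)].
Proof.
move=> k0 c0 cnd /concave_function_ge cc.
have slopes u v : 0 <= u -> u < k -> k < v ->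
    (c v - c k) / (v - k) <= (c k - c u) / (k - u).
  move=> u0 uk kv.
  have ku0 : 0 < k - u by rewrite subr_gt0.
  have vk0 : 0 < v - k by rewrite subr_gt0.
  have vu0 : 0 < v - u by rewrite subr_gt0 (lt_trans uk).
  have v0 : 0 <= v by rewrite ltW// (lt_trans k0).
  have t0 : 0 <= (v - k) / (v - u) by rewrite divr_ge0// ltW.
  have t1 : (v - k) / (v - u) <= 1.
    by rewrite ler_pdivrMr// mul1r lerB// ltW.
  have := cc _ _ _ t0 t1 u0 v0.
  have -> : (v - k) / (v - u) * u + (1 - (v - k) / (v - u)) * v = k.
    by field; rewrite gt_eqF.
  have -> : (v - k) / (v - u) * c u + (1 - (v - k) / (v - u)) * c v =
            ((v - k) * c u + (k - u) * c v) / (v - u).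
    by field; rewrite gt_eqF.
  rewrite ler_pdivrMr// => h.
  rewrite ler_pdivrMr// mulrAC ler_pdivlMr//.
  by nra.
pose S := [set (c v - c k) / (v - k) | v in [set v | k < v]].
have Sub u : 0 <= u -> u < k -> ubound S ((c k - c u) / (k - u)).
  by move=> u0 uk _ [v kv <-]; exact: slopes.
have S_v v : k < v -> (c v - c k) / (v - k) <= sup S.
  move=> kv; apply: ub_le_sup; last by exists v.
  by exists ((c k - c 0) / (k - 0)); exact: Sub.
have S_u u : 0 <= u -> u < k -> sup S <= (c k - c u) / (k - u).
  move=> u0 uk; apply: sup_le_ub; last exact: Sub.
  by exists ((c (k + 1) - c k) / (k + 1 - k)), (k + 1) => //=; rewrite ltrDl.
exists (sup S); split.
- apply: le_trans (S_v (k + 1) _); last by rewrite ltrDl.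
  rewrite divr_ge0 ?subr_ge0 ?lerDl//.
  by apply: cnd; rewrite ?in_itv/= ?andbT ?addr_ge0 ?lerDl ?(ltW k0).
- have := S_u 0 (lexx _) k0; rewrite subr0 ler_pdivlMr// => /le_trans; apply.
  by rewrite lerBlDr lerDl c0.
- move=> u u0; have [uk|ku|->] := ltgtP u k.
  + have := S_u u u0 uk; rewrite ler_pdivlMr ?subr_gt0//; lra.
  + have := S_v u ku; rewrite ler_pdivrMr ?subr_gt0//; lra.
  + by rewrite subrr mulr0 addr0.
Qed.

End supporting_line.

(** * Borel sets of the square of a separable metric space *)

Section borel_product.
Context (R : realType) (X : completeMetricType R).

Lemma preimage_generator_measurable (S T : pointedType) (GS : set (set S))
    (GT : set (set T)) (f : S -> T) :
    (forall A, GT A -> GS (f @^-1` A)) ->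
  measurable_fun [set: g_sigma_algebraType GS]
    (f : g_sigma_algebraType GS -> g_sigma_algebraType GT).
Proof.
move=> GST; apply: (@measurability _ _ (g_sigma_algebraType GS)
  (g_sigma_algebraType GT) setT f GT) => //.
by move=> _ [A oA <-]; rewrite setTI; apply: sub_sigma_algebra; exact: GST.
Qed.

Lemma preimage_itv_measurable (S : pointedType) (GS : set (set S)) (f : S -> R) :
    (forall a b, GS (f @^-1` `]a, b[)) ->
  measurable_fun [set: g_sigma_algebraType GS]
    (f : g_sigma_algebraType GS -> R).
Proof.
move=> GSf; apply: (measurability _ (RGenOpens.measurableE R)).
by move=> _ [_ [a [b ->]] <-]; rewrite setTI; apply: sub_sigma_algebra.
Qed.

Lemma mdist_continuous :
  continuous (fun z : (X * X)%type => mdist (z.1 : X) (z.2 : X)).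
Proof.
move=> [a b]; apply/cvgrPdist_lt => /= e e0.
have e20 : 0 < e / 2 by rewrite divr_gt0.
exists (ball a (e / 2), ball b (e / 2)); first by split; exact: nbhsx_ballx.
move=> [a' b'] /= []; rewrite !ballEmdist/= => aa' bb'.
have t1 := metric_triangle a a' b; have t2 := metric_triangle a' b' b.
have t3 := metric_triangle a' a b'; have t4 := metric_triangle a b b'.
have s1 := metric_sym a a'; have s2 := metric_sym b b'.
by rewrite ltr_norml; apply/andP; split; lra.
Qed.

Lemma mdist_measurable : measurable_fun [set: borel (X * X)%type]
  (fun z : borel (X * X)%type => mdist (z.1 : X) (z.2 : X)).
Proof.
apply: preimage_itv_measurable => a b.
by have /continuousP := mdist_continuous; apply; exact: interval_open.
Qed.

Lemma mdist_to_measurable (x0 : X) :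
  measurable_fun [set: borel X] (fun x : borel X => mdist (x : X) x0).
Proof.
apply: preimage_itv_measurable => a b.
suff /continuousP : continuous (fun x : X => mdist x x0).
  by apply; exact: interval_open.
move=> x; apply: (@continuous_comp _ _ _ (fun x => (x, x0))
  (fun z : (X * X)%type => mdist z.1 z.2)).
  by apply: cvg_pair; [exact: cvg_id|exact: cvg_cst].
exact: mdist_continuous.
Qed.

(** Couplings live on the Borel sigma-algebra of the product topology, product
    measures on the product sigma-algebra.  Separability makes the former no
    larger than the latter: an open set of the square is the union of the
    countably many boxes it contains whose sides are balls centred in the
    dense set with radii 1 / (n + 1). *)
Lemma separable_borel_prod : separable X ->
  measurable_fun [set: (borel X * borel X)%type]
    (id : (borel X * borel X)%type -> borel (X * X)%type).
Proof.
move=> [S cS dS].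
apply: (@measurability _ _ (borel X * borel X)%type (borel (X * X)%type)
  setT id (@open (X * X)%type)) => //.
move=> _ [U oU <-]; rewrite setTI preimage_id.
pose r (n : nat) : R := n.+1%:R^-1.
have r0 n : 0 < r n by rewrite /r invr_gt0.
(* Interiors make the sides open by construction; the next steps show that they
   still cover. *)
pose Bx (p : X) n : set X := (ball p (r n))°.
pose box (i : X * X * nat) : set (borel X * borel X)%type :=
  Bx i.1.1 i.2 `*` Bx i.1.2 i.2.
pose D := [set i : X * X * nat | [/\ S i.1.1, S i.1.2 & box i `<=` U]].
have -> : U = \bigcup_(i in D) box i.
  apply/seteqP; split; last by move=> z [i [_ _ iU] /iU].
  move=> [x y] Uxy.
  have : nbhs (x, y) U by apply: open_nbhs_nbhs.
  move=> [[A B]/= [nA nB] ABU].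
  have /nbhs_ballP[e1 /= e10 xA] := nA.
  have /nbhs_ballP[e2 /= e20 yB] := nB.
  (* A box centred within r n of (x, y) lies within 2 r n of it. *)
  have e0 : 0 < Num.min e1 e2 / 2 by rewrite divr_gt0// lt_min e10.
  have [n ne] : exists n, r n < Num.min e1 e2 / 2.
    have [n _ /(_ n (leqnn n))] := near_infty_natSinv_lt (PosNum e0).
    by exists n.
  have near_S (z : X) : exists2 s, S s & ball z (r n) s /\ Bx s n z.
    have [s [Os Ss]] : (ball z (r n))° `&` S !=set0.
      apply: dS; last exact: open_interior.
      by exists z; exact: nbhsx_ballx.
    exists s => //; split; first exact: interior_subset.
    have zs : ball z (r n) s by exact: interior_subset.
    rewrite /Bx /interior; apply/nbhs_ballP.
    move: (zs); rewrite ballEmdist/= => zs'.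
    exists (r n - mdist z s); first by rewrite /= subr_gt0.
    move=> w; rewrite !ballEmdist/= => zw.
    rewrite (le_lt_trans (metric_triangle s z w))// metric_sym.
    by rewrite -ltrBrDl.
  have [p Sp [xp Bpx]] := near_S x.
  have [q Sq [yq Bqy]] := near_S y.
  exists (p, q, n) => //=; split => //= -[a b].
  move=> [/= /interior_subset pa /interior_subset qb].
  apply: ABU; split => /=.
  - apply: xA; have := ball_triangle xp pa.
    apply: le_ball; rewrite (le_trans (ltW (ltrD ne ne)))//.
    by rewrite -splitr ge_min lexx.
  - apply: yB; have := ball_triangle yq qb.
    apply: le_ball; rewrite (le_trans (ltW (ltrD ne ne)))//.
    by rewrite -splitr ge_min lexx orbT.
have mbox i : measurable (box i).
  by apply: measurableX; apply: sub_sigma_algebra; exact: open_interior.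
have cD : countable D.
  apply: (@sub_countable _ _ _ (S `*` S `*` [set: nat])).
    by apply: subset_card_le => -[[p q] n] [/= Sp Sq _].
  by apply: countableX => //; exact: countableX.
rewrite bigcup_set_type; apply: countable_bigcupT_measurable => //.
by rewrite (eq_countable (card_setT D)).
Qed.

End borel_product.

(** * Coupling two laws along their common part *)

Section coupling.
Local Open Scope ereal_scope.
Context (R : realType).

(** Pushing m forward along f is binding it to the kernel of Dirac masses at
    f x. *)
Lemma image_measure d d' (S : measurableType d) (T : measurableType d')
    (m : {measure set S -> \bar R}) (f : S -> T) :
    m setT < +oo -> measurable_fun [set: S] f ->
  exists m' : {measure set T -> \bar R},
    (forall A, measurable A -> m' A = m (f @^-1` A)) /\
    (forall g : T -> \bar R,
       (forall y, 0 <= g y) -> measurable_fun [set: T] g ->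
       \int[m']_y g y = \int[m]_x g (f x)).
Proof.
move=> mfin mf; have [m' [m'E m'int]] := kernel_bind (kdirac mf) mfin.
exists m'; split=> [A mA|g g0 mg].
  rewrite m'E (eq_integral (fun x => (\1_(f @^-1` A) x)%:E)); last first.
    move=> x _; rewrite /kdirac/= diracE indicE.
    by congr (_%:R%:E); apply/idP/idP; rewrite !inE.
  have mfA : measurable (f @^-1` A) by have := mf measurableT A mA; rewrite setTI.
  by rewrite integral_indic ?setIT.
rewrite m'int//; apply: eq_integral => x _.
by rewrite integral_dirac// diracT mul1e.
Qed.

(** Couple m with itself on the diagonal, at no cost, and the residuals by the
    product D1 x D2 / q.  The latter has marginals D1 and D2, both of mass q,
    and the triangle inequality through x0 bounds its cost. *)
Lemma wasserstein_le_residual (X : completeMetricType R) (x0 : X)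
    (mu1 mu2 m D1 D2 : {measure set (borel X) -> \bar R}) (q : R) :
    separable X ->
    mu1 setT = 1 -> D1 setT = q%:E -> D2 setT = q%:E ->
    (forall A, measurable A -> mu1 A = m A + D1 A) ->
    (forall A, measurable A -> mu2 A = m A + D2 A) ->
  wasserstein mu1 mu2 <=
    \int[D1]_x (mdist (x : X) x0)%:E + \int[D2]_x (mdist (x : X) x0)%:E.
Proof.
move=> sX mu1T D1T D2T mu1E mu2E.
have q0 : (0 <= q)%R by rewrite -lee_fin -D1T.
have [E1 E1E] : exists m' : {finite_measure set (borel X) -> \bar R},
    forall A, m' A = D1 A by apply: finite_measure_of; rewrite D1T ltry.
have [E2 E2E] : exists m' : {finite_measure set (borel X) -> \bar R},
    forall A, m' A = D2 A by apply: finite_measure_of; rewrite D2T ltry.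
pose prod : {measure set (borel X * borel X)%type -> \bar R} := E1 \x E2.
have prodE A B : measurable A -> measurable B -> prod (A `*` B) = D1 A * D2 B.
  move=> mA mB; rewrite [LHS]product_measure1E//.
  by congr (_ * _); [exact: E1E|exact: E2E].
have prodT : prod setT < +oo by rewrite -setXTT prodE// D1T D2T ltry.
have mT : m setT < +oo.
  apply: le_lt_trans (ltry 1%R).
  by rewrite -mu1T mu1E// leeDl.
have mdiag : measurable_fun [set: borel X]
    ((fun x => (x, x)) : borel X -> borel (X * X)%type).
  apply: preimage_generator_measurable.
  apply/(@continuousP X (X * X)%type) => x.
  by apply: cvg_pair; exact: cvg_id.
have [G1 [G1E G1int]] := image_measure mT mdiag.
have [G2 [G2E G2int]] := image_measure prodT (separable_borel_prod sX).
(* If q = 0 then q^-1 = 0 and D1, D2 vanish, so that the same formula is still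
   a coupling. *)
have qV0 : (0 <= q^-1)%R by rewrite invr_ge0.
pose G0 : {measure set (borel (X * X)%type) -> \bar R} :=
  measure_add G1 (mscale (NngNum qV0) G2).
have G0E A : G0 A = G1 A + (q^-1)%:E * G2 A by exact: measure_addE.
have qD (D : {measure set (borel X) -> \bar R}) A :
    D setT = q%:E -> measurable A -> (q^-1)%:E * (D A * q%:E) = D A.
  move=> DT mA; have [q_eq0|q_neq0] := eqVneq q 0%R.
    suff -> : D A = 0 by rewrite mul0e mule0.
    have DA : D A <= q%:E by rewrite -DT le_measure ?inE.
    by apply/eqP; rewrite eq_le measure_ge0 andbT (le_trans DA)// q_eq0.
  by rewrite muleCA -EFinM mulVf// mule1.
have mfst : measurable_fun [set: borel (X * X)%type] (fst : _ -> borel X).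
  apply: preimage_generator_measurable.
  by apply/(@continuousP (X * X)%type X) => z; exact: cvg_fst.
have msnd : measurable_fun [set: borel (X * X)%type] (snd : _ -> borel X).
  apply: preimage_generator_measurable.
  by apply/(@continuousP (X * X)%type X) => z; exact: cvg_snd.
have G0fst (A : set (borel X)) : measurable A ->
    G0 ((fst : borel (X * X)%type -> borel X) @^-1` A) = mu1 A.
  move=> mA; have mA' := mfst measurableT _ mA; rewrite setTI in mA'.
  rewrite G0E G1E// G2E// mu1E//; congr (_ + _).
  have -> : id @^-1` (fst @^-1` A) = A `*` [set: borel X]
      :> set (borel X * borel X)%type.
    by apply/seteqP; split => z //= [].
  by rewrite prodE// D2T qD.
have G0snd (A : set (borel X)) : measurable A ->
    G0 ((snd : borel (X * X)%type -> borel X) @^-1` A) = mu2 A.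
  move=> mA; have mA' := msnd measurableT _ mA; rewrite setTI in mA'.
  rewrite G0E G1E// G2E// mu2E//; congr (_ + _).
  have -> : id @^-1` (snd @^-1` A) = [set: borel X] `*` A
      :> set (borel X * borel X)%type.
    by apply/seteqP; split => z //= [].
  by rewrite prodE// D1T muleC [q%:E * _]muleC muleC qD.
have G0T : G0 setT = 1 by rewrite -(preimage_setT fst) G0fst.
have [G GE] := probability_of G0T.
have mdist_meas : measurable_fun [set: borel (X * X)%type]
    (fun z => (mdist (z.1 : X) (z.2 : X))%:E).
  by apply/measurable_EFinP; exact: mdist_measurable.
have dx0_meas : measurable_fun [set: borel X] (fun x => (mdist (x : X) x0)%:E).
  by apply/measurable_EFinP; exact: mdist_to_measurable.
have d_ge0 (x y : X) : 0 <= (mdist x y)%:E by rewrite lee_fin mdist_ge0.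
apply: (@le_trans _ _ (\int[G0]_z (mdist (z.1 : X) (z.2 : X))%:E)).
  apply: ereal_inf_lbound; exists G.
    by move=> A mA; rewrite -G0fst// -G0snd//; split; exact: GE.
  by apply: eq_measure_integral => A mA _; exact: GE.
rewrite ge0_integral_measure_add//= ge0_integral_mscale//= G1int//.
rewrite integral0_eq ?add0e; last by move=> x _; rewrite mdistxx.
rewrite G2int//.
set c1 := \int[D1]_x _; set c2 := \int[D2]_x _.
have c1_ge0 : 0 <= c1 by apply: integral_ge0.
have c2_ge0 : 0 <= c2 by apply: integral_ge0.
apply: (@le_trans _ _ ((q^-1)%:E * (c1 * q%:E + c2 * q%:E))); last first.
  rewrite -ge0_muleDl// muleCA -EFinM.
  have [->|q_neq0] := eqVneq q 0%R; first by rewrite mulr0 mule0 adde_ge0.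
  by rewrite mulVf// mule1.
rewrite lee_wpmul2l ?lee_fin//.
have sum_meas : measurable_fun [set: (borel X * borel X)%type]
    (fun z => (mdist (z.1 : X) x0)%:E + (mdist (z.2 : X) x0)%:E).
  apply: emeasurable_funD.
  - exact: (measurableT_comp dx0_meas measurable_fst).
  - exact: (measurableT_comp dx0_meas measurable_snd).
apply: (@le_trans _ _
    (\int[prod]_z ((mdist (z.1 : X) x0)%:E + (mdist (z.2 : X) x0)%:E))).
  apply: ge0_le_integral => //.
  - exact: (measurableT_comp mdist_meas (separable_borel_prod sX)).
  - by move=> z _; rewrite -EFinD lee_fin (metric_sym z.2) metric_triangle.
rewrite [leLHS](@fubini_tonelli1 _ _ _ _ _ E1 E2 _ sum_meas); last first.
  by move=> z; rewrite adde_ge0.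
rewrite (@eq_measure_integral _ _ _ _ D1); last by move=> A mA _; exact: E1E.
rewrite (eq_integral
  (fun x : borel X => (mdist (x : X) x0)%:E * q%:E + c2)); last first.
  move=> x _; rewrite /fubini_F/=.
  rewrite (@eq_measure_integral _ _ _ _ D2); last by move=> A mA _; exact: E2E.
  by rewrite ge0_integralD// integral_cst//= D2T.
rewrite ge0_integralD//; last 2 first.
- by move=> x _; rewrite mule_ge0// lee_fin.
- by apply: emeasurable_funM => //; exact: measurable_cst.
by rewrite integral_cst// D1T ge0_integralZr// lee_fin.
Qed.

End coupling.

(** * Consequences of the drift condition *)

Section drift.
Local Open Scope ereal_scope.
Context (R : realType).

Lemma measurable_sublevel d (X : measurableType d) (V : X -> R) (a : R) :
  measurable_fun [set: X] V -> measurable [set x | (V x <= a)%R].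
Proof.
move=> /measurable_EFinP mV.
by have := emeasurable_fun_infty_c measurableT mV a%:E; rewrite setTI.
Qed.

(** Markov's inequality for the complement of the sublevel set. *)
Lemma sublevel_probability_ge d (X : measurableType d) (mu : probability X R)
    (V : X -> R) (K r : R) :
    measurable_fun [set: X] V -> (forall x, 0 <= V x)%R ->
    (0 < K)%R -> (0 < r)%R ->
    \int[mu]_x (V x)%:E <= K%:E ->
  (1 - r^-1)%:E <= mu [set x | (V x <= r * K)%R].
Proof.
move=> mV V0 K0 r0 muV; set C := [set x | _].
have mC : measurable C by exact: measurable_sublevel.
have muC : (fine (mu C))%:E = mu C by rewrite fineK// fin_num_measure.
have p1 : (fine (mu C) <= 1)%R by rewrite -lee_fin muC; exact: probability_le1.
have : ((1 - (1 - fine (mu C))) * 0 + (1 - fine (mu C)) * (r * K))%:E <=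
    \int[mu]_x (V x)%:E.
  apply: (@integral_ge_two_levels _ _ _ _ (~` C)) => //.
  - exact: measurableC.
  - exact/measurable_EFinP.
  - exact: probability_setT.
  - by rewrite subr_ge0.
  - by rewrite EFinB muC -probability_setC.
  - by rewrite mulr_ge0// ltW.
  - by move=> x xC; rewrite lee_fin ltW// ltNge; apply/negP.
move=> /le_trans /(_ muV); rewrite mulr0 add0r lee_fin mulrA.
rewrite -[leRHS]mul1r ler_pM2r// => pr.
by rewrite -muC lee_fin lerBlDr -lerBlDl -[leRHS]mul1r ler_pdivlMr.
Qed.

(** Here N stands for D P.  Jensen's inequality for a concave majorant c of f as
    a function of V, in terms of a supporting line of c at K with a = c(K) and
    slope s: integrating the line only needs the mass and the V-mean of N.  The
    condition s * K <= a lets both terms of the line be integrated as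
    nonnegative functions. *)
Lemma integral_bind_drift_le d (X : measurableType d) (P : R.-pker X ~> X)
    (D N : {measure set X -> \bar R}) (V f : X -> R) (K q a s : R) :
    measurable_fun [set: X] V -> (forall x, 0 <= V x)%R -> (0 <= K)%R ->
    (forall x, \int[P x]_y (V y)%:E <= K%:E) ->
    measurable_fun [set: X] f -> (forall x, 0 <= f x)%R ->
    (0 <= s)%R -> (s * K <= a)%R -> (forall x, f x <= a + s * (V x - K))%R ->
    D setT = q%:E -> N setT = q%:E ->
    \int[N]_x (V x)%:E = \int[D]_x \int[P x]_y (V y)%:E ->
  \int[N]_x (f x)%:E <= (a * q)%:E.
Proof.
move=> mV V0 K0 PV mf f0 s0 sKa fV DT NT NV.
have mVE : measurable_fun [set: X] (fun x => (V x)%:E) by exact/measurable_EFinP.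
have NVq : \int[N]_x (V x)%:E <= (K * q)%:E.
  rewrite NV EFinM -DT -integral_cst//; apply: ge0_le_integral => //.
  - by move=> x _; apply: integral_ge0 => y _; rewrite lee_fin.
  - apply: measurable_fun_integral_kernel => // U mU.
    exact: measurable_kernel.
have b0 : (0 <= a - s * K)%R by rewrite subr_ge0.
apply: (@le_trans _ _ (\int[N]_x ((a - s * K)%:E + s%:E * (V x)%:E))).
  apply: ge0_le_integral => //.
  - by move=> x _; rewrite lee_fin.
  - exact/measurable_EFinP.
  - by apply: emeasurable_funD => //; exact: measurable_funeM.
  - move=> x _; rewrite -EFinM -EFinD lee_fin (le_trans (fV x))//.
    by rewrite le_eqVlt; apply/orP; left; apply/eqP; ring.
rewrite ge0_integralD//; last 2 first.
- by move=> x _; rewrite mule_ge0 ?lee_fin.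
- exact: measurable_funeM.
rewrite integral_cst// NT ge0_integralZl//; last by move=> x _; rewrite lee_fin.
apply: (@le_trans _ _ ((a - s * K)%:E * q%:E + s%:E * (K * q)%:E)).
  by rewrite leeD2l// lee_wpmul2l// lee_fin.
by rewrite -!EFinM -EFinD lee_fin le_eqVlt; apply/orP; left; apply/eqP; ring.
Qed.

End drift.

(** * Convergence in Wasserstein distance *)

Theorem corollary3p3 (R : realType) (X : completeMetricType R)
    (hsep : separable X)
    (P : R.-pker (borel X) ~> (borel X)) (Pi : probability (borel X) R)
    (hPi : unique_invariant P Pi)
    (V : borel X -> R) (mV : measurable_fun setT V) (V_ge0 : forall x, 0 <= V x)
    (K : R) (K_gt0 : 0 < K)
    (hPV : forall x, (\int[P x]_y (V y)%:E <= K%:E)%E)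
    (r : R) (r_gt1 : 1 < r)
    (alpha : R) (alpha_gt0 : 0 < alpha) (alpha_le1 : alpha <= 1)
    (nu : probability (borel X) R)
    (hminor : forall x, V x <= r * K -> forall B : set (borel X),
       measurable B -> (alpha%:E * nu B <= P x B)%E)
    (x0 : X) (c : R -> R)
    (c_ge0 : forall u : R, 0 <= u -> 0 <= c u)
    (c_nd : {in `[0, +oo[ &, nondecreasing_fun c})
    (c_concave : @concave_function R R^o [set` `[0 : R, +oo[] c)
    (hdist : forall x : X, mdist x x0 <= c (V x)) :
  forall (x : X) (t : nat),
    (wasserstein (kiter P t.+1 x) Pi
       <= (2 * c K * rho (1 - r^-1) alpha t)%:E)%E.
Proof.
move=> x t; case: hPi => PiP _.
set gamma := 1 - r^-1.
have r_gt0 : 0 < r by rewrite (lt_trans _ r_gt1).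
have gamma_gt0 : 0 < gamma by rewrite /gamma subr_gt0 invf_lt1.
have gamma_lt1 : gamma < 1 by rewrite /gamma ltrBlDr ltrDl invr_gt0.
pose C : set (borel X) := [set y | V y <= r * K].
have mC : measurable C by exact: measurable_sublevel.
have PC y : (gamma%:E <= P y C)%E.
  have [Py PyE] := probability_of (prob_kernel y : P y setT = 1%E).
  rewrite -PyE; apply: sublevel_probability_ge => //.
  by rewrite (@eq_measure_integral _ _ _ _ (P y))// => A mA _; exact: PyE.
rewrite rho_survival//.
have [||m [_ [mT _ mP _]]] :=
  @kiter_minorization _ _ _ P C nu gamma alpha t mC _ _ PC hminor.
- by rewrite !ltW.
- by rewrite alpha_le1 ltW.
set q := (survival gamma alpha t).1 in mT *.
have mPi A : measurable A -> (m A <= Pi A)%E.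
  move=> mA; rewrite -(invariant_kiter t PiP mA).
  apply: (@le_trans _ _ (\int[Pi]_y m A)%E).
    by rewrite integral_cst// [X in (_ * X)%E]probability_setT mule1.
  apply: ge0_le_integral => //; first exact: measurable_kernel.
  by move=> y _; exact: mP.
(* N is D P for the residual D of mu above m, so mu P = m P + N. *)
have residual (mu : {measure set (borel X) -> \bar R}) :
    mu setT = 1%E -> (forall A, measurable A -> m A <= mu A)%E ->
  exists D N : {measure set (borel X) -> \bar R},
    [/\ D setT = q%:E, N setT = q%:E,
        forall f : borel X -> \bar R, (forall y, 0 <= f y)%E ->
          measurable_fun [set: borel X] f ->
          (\int[N]_y f y = \int[D]_y \int[P y]_z f z)%E &
        forall A, measurable A -> (\int[mu]_y P y A = \int[m]_y P y A + N A)%E].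
  move=> muT mmu.
  have mufin : (mu setT < +oo)%E by rewrite muT ltry.
  have [D muE] := measure_residual mufin mmu.
  have DT : D setT = q%:E.
    have DTfin : D setT \is a fin_num.
      rewrite ge0_fin_numE//; apply: le_lt_trans mufin.
      by rewrite muE// leeDr.
    have := muE _ measurableT; rewrite muT mT -(fineK DTfin) -EFinD => -[qE].
    by congr (_%:E); lra.
  have Dfin : (D setT < +oo)%E by rewrite DT ltry.
  have [N [NE Nint]] := kernel_bind P Dfin.
  exists D, N; split => //.
    rewrite NE (eq_integral (fun=> 1%E)); last by move=> y _; rewrite prob_kernel.
    by rewrite integral_cst// mul1e.
  move=> A mA; rewrite [LHS](@eq_measure_integral _ _ _ _ (measure_add m D)).
    rewrite ge0_integral_measure_add//; last exact: measurable_kernel.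
    by rewrite NE.
  by move=> B mB _; rewrite muE//; exact/esym/measure_addE.
have mfin : (m setT < +oo)%E by rewrite mT ltry.
have [mm [mmE _]] := kernel_bind P mfin.
have [D1 [N1 [D1T N1T N1int N1E]]] :=
  residual (kiter P t x) (prob_kernel (x : borel X)) (mP x).
have [D2 [N2 [D2T N2T N2int N2E]]] := residual Pi (probability_setT Pi) mPi.
apply: le_trans.
  apply: (@wasserstein_le_residual R X x0 _ _ mm N1 N2 q hsep _ N1T N2T).
  - exact: prob_kernel.
  - by move=> A mA; rewrite mmE -N1E// -kiterSr.
  - by move=> A mA; rewrite mmE -N2E// PiP.
have [s [s_ge0 sK cs]] := concave_supporting_line K_gt0 c_ge0 c_nd c_concave.
have mdx0 := @mdist_to_measurable R X x0.
(* Jensen's inequality for c against the residual after one more step. *)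
have bound (D N : {measure set (borel X) -> \bar R}) :
    D setT = q%:E -> N setT = q%:E ->
    (forall f : borel X -> \bar R, (forall y, 0 <= f y)%E ->
          measurable_fun [set: borel X] f ->
          (\int[N]_y f y = \int[D]_y \int[P y]_z f z)%E) ->
    (\int[N]_y (mdist (y : X) x0)%:E <= (c K * q)%:E)%E.
  move=> DT NT Nint.
  apply: (@integral_bind_drift_le _ _ _ P D N V _ K q (c K) s) => //.
  - exact: ltW.
  - by move=> y; exact: mdist_ge0.
  - by move=> y; rewrite (le_trans (hdist y))// cs.
  - by apply: Nint; [move=> y; rewrite lee_fin|exact/measurable_EFinP].
apply: le_trans (leeD (bound _ _ D1T N1T N1int) (bound _ _ D2T N2T N2int)) _.
by rewrite -EFinD lee_fin le_eqVlt; apply/orP; left; apply/eqP; ring.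
Qed.
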